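(* Voxel representations of the complete graph $K_n$ require $\Omega(n^2)$ voxels. That is, there is an absolute constant $c>0$ such that for every integer $n\ge 1$, every voxel representation of $K_n$ has size at least $c\,n^2$.
   Context: A voxel is a cell of the unit cube grid in 3-dimensional space; two distinct voxels are adjacent if they share a face. A blob is a nonempty finite set of voxels that is connected with respect to this adjacency. A voxel representation of a finite simple graph $G=(V,E)$ assigns to each vertex $v\in V$ a blob $B_v$ such that the blobs of distinct vertices are disjoint and, for all distinct $u,v\in V$, some voxel of $B_u$ is adjacent to some voxel of $B_v$ if and only if $uv\in E$. Its size is $\sum_{v\in V}|B_v|$. *)

(* Defs.v *)
From mathcomp Require Import all_boot all_order all_algebra.
From mathcomp Require Import finmap.
From mathcomp Require Import reals.

Set Implicit Arguments.
Unset Strict Implicit.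
Unset Printing Implicit Defensive.

Import Order.TTheory GRing.Theory Num.Theory.
Local Open Scope fset_scope.
Local Open Scope ring_scope.

Record sgraph := SGraph {
  vertex :> finType;
  edge : rel vertex;
  edge_sym : symmetric edge;
  edge_irr : irreflexive edge }.

Definition complete_rel (n : nat) : rel 'I_n := fun i j => i != j.

Lemma complete_sym n : symmetric (@complete_rel n).
Proof. by move=> i j; rewrite /complete_rel eq_sym. Qed.

Lemma complete_irr n : irreflexive (@complete_rel n).
Proof. by move=> i; rewrite /complete_rel eqxx. Qed.

Definition complete_graph (n : nat) : sgraph :=
  SGraph (@complete_sym n) (@complete_irr n).

(* The vector p stands for the cell [p_0, p_0 + 1] x [p_1, p_1 + 1] x
   [p_2, p_2 + 1]. *)
Notation voxel := 'rV[int]_3.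

Definition unit_vec (i : 'I_3) : voxel := delta_mx 0 i.

(* The pair (q, i) stands for the unit square of the grid that is orthogonal to
   the i-th axis and has q as its least corner; the two faces of the voxel p
   orthogonal to that axis are thus (p, i) and (p + unit_vec i, i). *)
Definition faces (p : voxel) : {fset 'rV[int]_3 * 'I_3} :=
  [fset (p, i) | i in 'I_3] `|` [fset (p + unit_vec i, i) | i in 'I_3].

Definition adjacent : rel voxel :=
  fun p q => (p != q) && (faces p `&` faces q != fset0).

(* Connectedness is that of the subgraph induced on B: paths stay inside B. *)
Definition is_blob (B : {fset voxel}) : Prop :=
  B != fset0 /\
  forall x y : B, connect (fun u v : B => adjacent (val u) (val v)) x y.

Definition in_contact (A B : {fset voxel}) : Prop :=
  exists p q : voxel, [/\ p \in A, q \in B & adjacent p q].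

Definition voxel_representation (G : sgraph) (B : G -> {fset voxel}) : Prop :=
  [/\ forall v : G, is_blob (B v),
      forall u v : G, u != v -> [disjoint B u & B v] &
      forall u v : G, u != v -> (in_contact (B u) (B v) <-> edge u v)].

Definition rep_size (G : sgraph) (B : G -> {fset voxel}) : nat :=
  (\sum_(v : G) #|` B v|)%N.

Lemma facesP (p : voxel) (f : 'rV[int]_3 * 'I_3) :
  reflect (f.1 = p \/ f.1 = p + unit_vec f.2) (f \in faces p).
Proof.
apply: (iffP idP) => [|].
  by rewrite in_fsetU => /orP[] /imfsetP[i _ ->]; [left|right].
case: f => q i /= H; rewrite in_fsetU; apply/orP.
by case: H => ->; [left|right]; apply/imfsetP; exists i.
Qed.

Lemma adjacentP (p q : voxel) :
  reflect (exists i, q = p + unit_vec i \/ p = q + unit_vec i) (adjacent p q).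
Proof.
have e0 i : unit_vec i != 0.
  by apply/eqP => /matrixP/(_ 0 i); rewrite !mxE !eqxx.
apply: (iffP andP) => [[npq /fset0Pn[[r i]]]|[i H]].
  rewrite in_fsetI => /andP[/facesP /= Hp /facesP /= Hq]; exists i.
  case: Hp Hq => -> [Hq|Hq]; [|by right|by left|].
  - by rewrite Hq eqxx in npq.
  - by move/addIr: Hq npq => ->; rewrite eqxx.
split.
  by case: H => ->; rewrite -subr_eq0 ?opprD ?addrA ?(addrAC _ _ (- q)) subrr
    add0r ?oppr_eq0.
apply/fset0Pn; case: H => ->.
  by exists (p + unit_vec i, i); rewrite in_fsetI;
    apply/andP; split; apply/facesP; [right|left].
by exists (q + unit_vec i, i); rewrite in_fsetI;
  apply/andP; split; apply/facesP; [left|right].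
Qed.

(* Main.v *)
Require Import Defs.
From mathcomp Require Import all_boot all_order all_algebra finmap reals.

Import Order.TTheory GRing.Theory Num.Theory.
Local Open Scope fset_scope.
Local Open Scope ring_scope.

(** A voxel has only six neighbours, and each neighbour lies in at most one blob,
    so a blob representing a vertex of degree d has at least d / 6 voxels.  In
    K_n, where moreover no blob is empty, n <= 6 |B_v| + 1 <= 7 |B_v| for
    every v, and summing over v gives n^2 <= 7 * size. *)

(** A direction is an axis with a sign, so the index type has 3 * 2 = 6 elements; this is the source
    of the factor 6. *)
Definition neighbor (p : voxel) (d : 'I_3 * bool) : voxel :=
  if d.2 then p + unit_vec d.1 else p - unit_vec d.1.

Lemma adjacent_neighbor (p q : voxel) :
  adjacent p q -> exists d, q = neighbor p d.
Proof.
case/adjacentP => i [->|->]; first by exists (i, true).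
by exists (i, false); rewrite /neighbor /= addrK.
Qed.

Lemma disjoint_blobs_inj {G : sgraph} {B : G -> {fset voxel}} {u v : G} {q : voxel} :
  voxel_representation B -> q \in B u -> q \in B v -> u = v.
Proof.
move=> [_ disjB _] qu qv; apply/eqP; apply/negPn/negP => /disjB /fdisjointP.
by move=> /(_ q qu); rewrite qv.
Qed.

Lemma degree_le_blob_size {G : sgraph} {B : G -> {fset voxel}} (u : G) :
  voxel_representation B -> (#|[set v | edge u v]| <= 6 * #|` B u|)%N.
Proof.
move=> repB; case: (repB) => _ _ contactB.
(* [owner] is [None] when the neighbouring cell lies in no blob, so the neighbours of [u] are
   counted through [Some]. *)
pose owner (x : B u * ('I_3 * bool)) :=
  [pick v | neighbor (val x.1) x.2 \in B v].
have Some_vertex_inj : injective (@Some G) by move=> v w [].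
rewrite -(card_imset _ Some_vertex_inj).
have le_owner : (#|[set Some v | v in [set v | edge u v]]| <= #|codom owner|)%N.
  apply/subset_leq_card/subsetP => _ /imsetP[v + ->]; rewrite inE => uv.
  have neq_uv : u != v by apply: contraTneq uv => ->; rewrite edge_irr.
  have [p [q [pu qv /adjacent_neighbor[d qE]]]] := (contactB u v neq_uv).2 uv.
  apply/codomP; exists ([` pu], d); rewrite /owner /= -qE.
  (* The vertex picked may a priori differ from [v]; disjointness of the blobs forces them to
     agree. *)
  case: pickP => [w qw|/(_ v)]; last by rewrite qv.
  by rewrite (disjoint_blobs_inj repB qv qw).
apply: leq_trans le_owner _; apply: leq_trans (card_size _) _.
by rewrite size_codom !card_prod card_ord card_bool -cardfE mulnC.
Qed.

Lemma complete_graph_blob_size {n : nat} {B : complete_graph n -> {fset voxel}}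
    (u : complete_graph n) :
  voxel_representation B -> (n <= 7 * #|` B u|)%N.
Proof.
move=> repB; have [/(_ u)[Bu0 _] _ _] := repB.
have := degree_le_blob_size u repB.
have -> : [set v | edge u v] = [set~ u].
  by apply/setP => v; rewrite !inE eq_sym.
rewrite cardsC1 card_ord => le_deg.
(* Splits [n <= 1 + n.-1]: nonemptiness of the blob bounds the 1, and the degree [n.-1] of [u] is at
   most six times the blob size. *)
apply: leq_trans (leqSpred n) _; rewrite (mulSn 6) -add1n.
by apply: leq_add; rewrite ?cardfs_gt0.
Qed.

Theorem mainTheorem6 (R : realType) :
  exists c : R, 0 < c /\
    forall n : nat, (1 <= n)%N ->
    forall B : complete_graph n -> {fset voxel},
      voxel_representation B -> c * n%:R ^+ 2 <= (rep_size B)%:R.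
Proof.
exists 7%:R^-1; split=> [|n _ B repB]; first by rewrite invr_gt0 ltr0n.
rewrite ler_pdivrMl ?ltr0n // -natrX -natrM ler_nat /rep_size big_distrr /=.
(* The square becomes the constant [n] summed over the [n] vertices, to be compared blob by blob. *)
rewrite -mulnn -{1}[n]card_ord -sum_nat_const.
by apply: leq_sum => u _; apply: complete_graph_blob_size.
Qed.
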